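(* Let $X$ be either $c_0(\mathbb{N})$ or $\ell^p(\mathbb{N})$ with $1\le p<\infty$. Then there exists a bounded linear operator $S$ on $X\oplus X$ such that $S$ is convex-cyclic, $S$ is not weakly hypercyclic, and $S^2$ is not convex-cyclic.
   Context: For a bounded linear operator $T$ on a Banach space $X$ and $x\in X$, the orbit is $Orb(T,x)=\{T^n x : n=0,1,2,\ldots\}$. $T$ is convex-cyclic if there is $x\in X$ such that the convex hull of $Orb(T,x)$ is (norm) dense in $X$. $T$ is weakly hypercyclic if there is $x\in X$ such that $Orb(T,x)$ is dense in $X$ in the weak topology. *)

(* Defs.v *)
From HB Require Import structures.
From mathcomp Require Import all_boot all_order all_algebra.
From mathcomp Require Import all_classical all_reals all_analysis.
From mathcomp Require Import complex.

Set Implicit Arguments.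
Unset Strict Implicit.
Unset Printing Implicit Defensive.

Import Order.TTheory GRing.Theory Num.Theory.
Import numFieldNormedType.Exports.

Local Open Scope classical_set_scope.
Local Open Scope ring_scope.

(* Norms in normedModType K take values in K itself, so for complex scalars the
   real-valued modulus and the embedding of R into K have to be kept explicit. *)
Variant ground := Reals | Complexes.

Section scalars.
Variable R : realType.

Definition ground_field (F : ground) : numFieldType :=
  match F with Reals => R | Complexes => R[i] end.

Definition modulus (F : ground) : ground_field F -> R :=
  match F with
  | Reals => fun x : R => `|x|
  | Complexes => fun z : R[i] => ComplexField.Normc.normc z
  end.

Definition of_real (F : ground) : R -> ground_field F :=
  match F with
  | Reals => fun x => x
  | Complexes => fun x => x%:C%C
  end.

Variable F : ground.
Implicit Types (a b : R) (x y : ground_field F).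

Lemma of_real_modulus x : of_real F (modulus x) = `|x|.
Proof. by case: F x. Qed.

Lemma of_real0 : of_real F 0 = 0.
Proof. by case: F. Qed.

Lemma of_realD a b : of_real F (a + b) = of_real F a + of_real F b.
Proof. by case: F => //=; rewrite rmorphD. Qed.

Lemma of_realM a b : of_real F (a * b) = of_real F a * of_real F b.
Proof. by case: F => //=; rewrite rmorphM. Qed.

Lemma of_real_le a b : (of_real F a <= of_real F b) = (a <= b).
Proof. by case: F => //=; rewrite lecR. Qed.

Lemma of_real_inj : injective (of_real F).
Proof. by case: F => [|a b []]. Qed.

Lemma modulus_ge0 x : 0 <= modulus x.
Proof. by rewrite -of_real_le of_real0 of_real_modulus. Qed.

Lemma modulus0 : modulus (0 : ground_field F) = 0.
Proof. by apply: of_real_inj; rewrite of_real_modulus normr0 of_real0. Qed.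

Lemma modulus_eq0 x : modulus x = 0 -> x = 0.
Proof.
by move=> x0; apply/eqP; rewrite -normr_eq0 -of_real_modulus x0 of_real0.
Qed.

Lemma modulusM x y : modulus (x * y) = modulus x * modulus y.
Proof. by apply: of_real_inj; rewrite of_realM !of_real_modulus normrM. Qed.

Lemma modulusD x y : modulus (x + y) <= modulus x + modulus y.
Proof. by rewrite -of_real_le of_realD !of_real_modulus ler_normD. Qed.

End scalars.

Section c0_normed.
Variables (R : realType) (F : ground).
Local Notation K := (ground_field R F).
Local Notation seqK := (nat -> K^o).

Definition c0_pred : {pred seqK} := fun x => `[< x @ \oo --> (0 : K^o) >].

Lemma c0_submod_closed : submod_closed c0_pred.
Proof.
split=> [|a x y /asboolP x0 /asboolP y0]; apply/asboolP; first exact: cvg_cst.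
rewrite -[X in _ --> X]addr0 -[X in _ --> X + _](scaler0 _ a).
by apply: cvgD => //; apply: cvgZr.
Qed.

HB.instance Definition _ :=
  GRing.isSubmodClosed.Build K seqK c0_pred c0_submod_closed.

Record c0_space := C0 { c0_val :> seqK; c0_valP : c0_val \in c0_pred }.

Local Notation c0 := c0_space.

HB.instance Definition _ := [isSub for c0_val].
HB.instance Definition _ := [Choice of c0 by <:].
HB.instance Definition _ := [SubChoice_isSubLmodule of c0 by <:].

Definition c0_norm (x : c0) : K :=
  of_real F (sup (range (fun n => modulus (x n)))).

Lemma c0_has_sup (x : c0) : has_sup (range (fun n => modulus (x n))).
Proof.
split; first by exists (modulus (x 0%N)), 0%N.
have /asboolP x0 := c0_valP x.
have : cvgn (x : seqK) by apply/cvg_ex; exists 0.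
move=> /cvg_seq_bounded/pinfty_ex_gt0[M M0 xM].
exists (modulus M) => _ [n _ <-]; rewrite -(of_real_le F) !of_real_modulus.
by rewrite (gtr0_norm M0); exact: xM.
Qed.

Lemma c0_modulus_le (x : c0) n : modulus (x n) <= sup (range (fun n => modulus (x n))).
Proof. by apply: sup_upper_bound; [exact: c0_has_sup|exists n]. Qed.

Lemma c0_normD x y : c0_norm (x + y) <= c0_norm x + c0_norm y.
Proof.
rewrite /c0_norm -of_realD of_real_le ge_sup//; first by case: (c0_has_sup (x + y)).
by move=> _ [n _ <-]; rewrite (le_trans (modulusD _ _))// lerD// c0_modulus_le.
Qed.

Lemma c0_normZ (a : K) x : c0_norm (a *: x) = `|a| * c0_norm x.
Proof.
rewrite /c0_norm -of_real_modulus -of_realM; congr of_real.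
have leZ (b : K) z : sup (range (fun n => modulus ((b *: z : c0) n))) <=
    modulus b * sup (range (fun n => modulus (z n))).
  rewrite ge_sup//; first by case: (c0_has_sup (b *: z)).
  by move=> _ [n _ <-]; rewrite modulusM ler_wpM2l ?modulus_ge0// c0_modulus_le.
apply/le_anti; rewrite leZ/=.
have [->|a0] := eqVneq a 0.
  rewrite modulus0 mul0r (le_trans (modulus_ge0 ((0 *: x : c0) 0%N)))//.
  exact: c0_modulus_le.
have ma0 : 0 < modulus a.
  by rewrite lt_def modulus_ge0 andbT; apply: contra_neq a0 => /modulus_eq0.
rewrite -ler_pdivlMl//.
have -> : (modulus a)^-1 = modulus a^-1.
  apply: (mulfI (lt0r_neq0 ma0)); rewrite -modulusM !divff// ?gt_eqF//.
  by apply: (@of_real_inj _ F); rewrite of_real_modulus normr1; case: F.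
have := leZ a^-1 (a *: x).
by rewrite scalerA mulVf// scale1r.
Qed.

Lemma c0_norm_eq0 x : c0_norm x = 0 -> x = 0.
Proof.
rewrite /c0_norm -(of_real0 R F) => /of_real_inj x0.
apply/val_inj/funext => n /=; apply: modulus_eq0.
by apply/le_anti; rewrite modulus_ge0 -{1}x0 c0_modulus_le.
Qed.

HB.instance Definition _ :=
  Lmodule_isNormed.Build K c0 c0_normD c0_normZ c0_norm_eq0.

End c0_normed.

Section lp_normed.
Variables (R : realType) (F : ground) (p : R) (p1 : 1 <= p).
Local Notation K := (ground_field R F).
Local Notation seqK := (nat -> K^o).

(* By Lnorm_counting, this is (\sum_n |x n| ^ p) ^ (1/p), possibly +oo. *)
Definition lp_enorm (x : seqK) : \bar R :=
  'N[counting]_(p%:E)[EFin \o (fun n => modulus (x n))]%E.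

(* The unused proof lets p1 be inferred by the instances below. *)
Definition lp_pred of 1 <= p : {pred seqK} := fun x => `[< (lp_enorm x < +oo)%E >].

Let p_gt0 : 0 < p. Proof. exact: lt_le_trans p1. Qed.

Lemma lp_enormE x :
  lp_enorm x = ((\sum_(n <oo) (modulus (x n) `^ p)%:E) `^ p^-1)%E.
Proof.
rewrite /lp_enorm (Lnorm_counting _ p_gt0); congr (_ `^ _)%E.
by apply: eq_eseriesr => n _; rewrite abse_EFin ger0_norm ?modulus_ge0.
Qed.

Lemma lp_enorm_ge0 x : (0 <= lp_enorm x)%E.
Proof. exact: Lnorm_ge0. Qed.

Lemma lp_enormD x y : (lp_enorm (x + y)%R <= lp_enorm x + lp_enorm y)%E.
Proof.
have pV0 : 0 <= p^-1 by rewrite invr_ge0 ltW.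
pose u n : R := modulus (x n) + modulus (y n).
have u0 n : 0 <= u n by rewrite addr_ge0 ?modulus_ge0.
apply: (@le_trans _ _ 'N[counting]_(p%:E)[EFin \o u]%E); last first.
  exact: minkowski_EFin.
rewrite lp_enormE (Lnorm_counting _ p_gt0).
under [X in (_ <= X `^ _)%E]eq_eseriesr do rewrite abse_EFin ger0_norm//.
have le_sum : (\sum_(n <oo) (modulus ((x + y)%R n) `^ p)%:E <=
               \sum_(n <oo) (u n `^ p)%:E)%E.
  apply: lee_nneseries => n _; first by rewrite lee_fin powR_ge0.
  by rewrite lee_fin ge0_ler_powR ?nnegrE ?modulus_ge0 ?modulusD// ltW.
have sum0 : (0 <= \sum_(n <oo) (modulus ((x + y)%R n) `^ p)%:E)%E.
  by apply: nneseries_ge0 => n _ _; rewrite lee_fin powR_ge0.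
apply: gt0_ler_poweR; rewrite ?in_itv//= ?sum0 ?leey//.
by rewrite (le_trans sum0 le_sum).
Qed.

Lemma lp_enormZ (a : K) x : lp_enorm (a *: x) = ((modulus a)%:E * lp_enorm x)%E.
Proof.
have sum0 : (0 <= \sum_(n <oo) (modulus (x n) `^ p)%:E)%E.
  by apply: nneseries_ge0 => n _ _; rewrite lee_fin powR_ge0.
rewrite !lp_enormE.
have -> : (\sum_(n <oo) (modulus ((a *: x) n) `^ p)%:E =
           (modulus a `^ p)%:E * \sum_(n <oo) (modulus (x n) `^ p)%:E)%E.
  rewrite -nneseriesZl ?lee_fin ?powR_ge0//; last first.
    by move=> n _; rewrite lee_fin powR_ge0.
  by apply: eq_eseriesr => n _; rewrite modulusM powRM ?modulus_ge0// EFinM.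
rewrite poweRM ?lee_fin ?powR_ge0// poweR_EFin -powRrM mulfV ?gt_eqF//.
by rewrite powRr1 ?modulus_ge0.
Qed.

Lemma lp_submod_closed : submod_closed (lp_pred p1).
Proof.
split=> [|a x y /asboolP xoo /asboolP yoo]; apply/asboolP.
  rewrite lp_enormE eseries0 => [|n _ _]; last by rewrite modulus0 powR0// gt_eqF.
  by rewrite poweR0r ?invr_eq0 ?gt_eqF// ltry.
apply: le_lt_trans (lp_enormD _ _) _; apply: lte_add_pinfty => //.
by rewrite lp_enormZ lte_mul_pinfty ?lee_fin ?modulus_ge0.
Qed.

HB.instance Definition _ :=
  GRing.isSubmodClosed.Build K seqK (lp_pred p1) lp_submod_closed.

Record lp_space := Lp { lp_val :> seqK; lp_valP : lp_val \in lp_pred p1 }.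

Local Notation lp := lp_space.

HB.instance Definition _ := [isSub for lp_val].
HB.instance Definition _ := [Choice of lp by <:].
HB.instance Definition _ := [SubChoice_isSubLmodule of lp by <:].

Definition lp_norm (x : lp) : K := of_real F (fine (lp_enorm x)).

Lemma lp_enorm_fin (x : lp) : lp_enorm x \is a fin_num.
Proof. by rewrite ge0_fin_numE ?lp_enorm_ge0//; have /asboolP := lp_valP x. Qed.

Lemma lp_valD (x y : lp) : lp_val (x + y) = lp_val x + lp_val y :> seqK.
Proof. by []. Qed.

Lemma lp_valZ (a : K) (x : lp) : lp_val (a *: x) = a *: lp_val x :> seqK.
Proof. by []. Qed.

Lemma lp_normD x y : lp_norm (x + y) <= lp_norm x + lp_norm y.
Proof.
rewrite /lp_norm -of_realD of_real_le -lee_fin EFinD !fineK ?lp_enorm_fin//.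
by rewrite lp_valD lp_enormD.
Qed.

Lemma lp_normZ (a : K) x : lp_norm (a *: x) = `|a| * lp_norm x.
Proof.
rewrite /lp_norm -of_real_modulus -of_realM; congr of_real.
by rewrite lp_valZ lp_enormZ fineM ?lp_enorm_fin.
Qed.

Lemma lp_norm_eq0 x : lp_norm x = 0 -> x = 0.
Proof.
rewrite /lp_norm -(of_real0 R F) => /of_real_inj x0.
have sx0 : lp_enorm x = 0%E by rewrite -(fineK (lp_enorm_fin x)) x0.
apply/val_inj/funext => n /=; apply: modulus_eq0.
have pge0 k : (0 <= (modulus (x k) `^ p)%:E)%E by rewrite lee_fin powR_ge0.
move: sx0; rewrite lp_enormE => /poweR_eq0_eq0 sx0.
have {}sx0 := sx0 (nneseries_ge0 (fun k _ _ => pge0 k)).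
apply: (@powR_eq0_eq0 _ _ p); apply/le_anti.
rewrite powR_ge0 andbT -lee_fin -[leRHS]sx0 (nneseriesD1 (n := n))//.
by rewrite leeDl// nneseries_ge0.
Qed.

HB.instance Definition _ :=
  Lmodule_isNormed.Build K lp lp_normD lp_normZ lp_norm_eq0.

End lp_normed.

Section dynamics.
Variables (K : numFieldType) (X : normedModType K).

(* In a numFieldType, 0 <= t forces t to be real, so the coefficients are real
   for complex scalars too. *)
Definition convex_hull (A : set X) : set X :=
  [set v | exists n (t : 'I_n -> K) (a : 'I_n -> X),
    [/\ forall i, 0 <= t i, \sum_(i < n) t i = 1, forall i, A (a i) &
        v = \sum_(i < n) t i *: a i]].

Definition Orb (T : X -> X) (x : X) : set X := range (fun n => iter n T x).

Definition bounded_operator (Y : normedModType K) (T : X -> Y) : Prop :=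
  exists M : K, forall x, `|T x| <= M * `|x|.

Definition topological_dual :=
  {f : {linear X -> K^o} | bounded_operator (f : X -> K^o)}.

Definition weak_topology :=
  sup_topology (fun f : topological_dual =>
    Topological.class (initial_topology (sval f : X -> K^o))).

HB.instance Definition _ := Topological.on weak_topology.

Definition convex_cyclic (T : X -> X) : Prop :=
  exists x, dense (convex_hull (Orb T x)).

Definition weakly_hypercyclic (T : X -> X) : Prop :=
  exists x, dense (Orb T x : set weak_topology).

End dynamics.

(* Main.v *)
(* Write mu = -1 (real scalars) or mu = i (complex scalars), and let S (x, y) =
   (A x, 2 B y), where B is the backward shift and A x agrees with 2 B x except
   that its coordinate 0 is 2 mu x_0.  Then f (x, y) = x_0 is an eigenvector of
   the adjoint of S for the eigenvalue 2 mu.  Hence f maps an S-orbit onto the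
   numbers c (2 mu)^n, which are not dense, and the convex hull of an S^2-orbit to
   convex combinations of c (4 mu^2)^n, where mu^2 is 1 or -1, so it stays away from
   c mu.  On the other hand, a Rolewicz-type vector (x, y) with x_0 = 1 brings the
   remaining coordinates of S^n (x, y) close to any finitely supported target for
   infinitely many n in each residue class mod 4; the numbers f (S^n (x, y)) =
   (2 mu)^n then point in the four directions mu^r, whose nonnegative
   combinations fill the scalar field, and a convex combination of four such
   S^n (x, y) also gets coordinate 0 right. *)
Require Import Defs.
From HB Require Import structures.
From mathcomp Require Import all_boot all_order all_algebra.
From mathcomp Require Import all_classical all_reals all_analysis.
From mathcomp Require Import complex zify lra ring.
Set Implicit Arguments.
Unset Strict Implicit.
Unset Printing Implicit Defensive.
Import Order.TTheory GRing.Theory Num.Theory.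
Import numFieldNormedType.Exports.
Local Open Scope classical_set_scope.
Local Open Scope ring_scope.

(** * Choice of sparse exponents with prescribed residues mod 4 *)

(** Each exponent is a multiple of 4 beyond everything chosen before, plus the residue. [L] stands
    for block lengths, which keeps blocks disjoint, and [2 ^+ b k] for the size of block [k], which
    makes later blocks negligible after [n i] doublings. *)
Lemma sparse_exponents (b L r : nat -> nat) : exists n : nat -> nat,
  [/\ forall k, n k = r k %[mod 4], forall k, (k.+1 + b k <= n k)%N &
      forall i k, (i < k)%N -> (n i + L i <= n k)%N /\ (n i + k.+1 + b k <= n k)%N].
Proof.
pose n := fix n k := if k is k'.+1
  then (4 * (n k' + L k' + k.+1 + b k) + r k)%N else (4 * (1 + b 0) + r 0)%N.
have nS k : n k.+1 = (4 * (n k + L k + k.+2 + b k.+1) + r k.+1)%N by [].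
have n0 : n 0%N = (4 * (1 + b 0) + r 0)%N by [].
clearbody n.
(* Growth is built in only between neighbours; monotonicity of [n k + L k] extends it to all pairs
   [i < k]. *)
have nle i k : (i <= k)%N -> (n i + L i <= n k + L k)%N.
  elim: k => [|k IH]; first by rewrite leqn0 => /eqP->.
  by rewrite leq_eqVlt => /predU1P[->//|/IH]; rewrite nS; lia.
exists n; split.
- by case=> [|k]; rewrite ?n0 ?nS mulnC modnMDl.
- by case=> [|k]; rewrite ?n0 ?nS; lia.
- by move=> i [//|k]; rewrite ltnS => /nle; rewrite nS; lia.
Qed.

Lemma injective_unbounded (f : nat -> nat) (N : nat) :
  injective f -> exists j, (N <= f j)%N.
Proof.
move=> fI; apply: contrapT => /forallNP fN.
have fltN j : (f j < N)%N by rewrite ltnNge; apply/negP/fN.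
have /leq_card : injective (fun j : 'I_N.+1 => Ordinal (fltN j)).
  by move=> j j' /(congr1 val)/fI/val_inj.
by rewrite !card_ord ltnn.
Qed.

(** * A summable sequence whose rescaled shifts approximate all given words *)

Section universal.
Variable K : numFieldType.
Implicit Types (s : seq K) (w : nat -> seq K) (n b : nat -> nat).

Lemma sum_nth_le s N : \sum_(j < N) `|s`_j| <= \sum_(x <- s) `|x|.
Proof.
elim: s N => [|x s IH] [|N].
- by rewrite big_ord0 big_nil.
- by rewrite big_nil big1 => // i _; rewrite nth_nil normr0.
- by rewrite big_ord0 sumr_ge0.
- by rewrite big_ord_recl big_cons /= lerD2l; exact: IH.
Qed.

(** Distinct [j] read distinct positions [j + m - a] of [s], so no entry is counted twice. *)
Lemma sum_nth_shift_le s a m J :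
  \sum_(j < J | (a <= j + m)%N) `|s`_(j + m - a)| <= \sum_(x <- s) `|x|.
Proof.
apply: le_trans (sum_nth_le s (J + m)).
rewrite -(big_mkord (fun j => a <= j + m)%N (fun j => `|s`_(j + m - a)|)).
rewrite -(big_mkord xpredT (fun j => `|s`_j|)).
apply: (@le_trans _ _ (\sum_(0 <= i < J + m | (a <= i)%N) `|s`_(i - a)|)).
  rewrite -{1}(addnK m J).
  rewrite -(big_addn 0 _ m (fun i => a <= i)%N (fun i => `|s`_(i - a)|)).
  by rewrite add0n [leRHS](@big_cat_nat _ _ _ m) ?leq_addl//= ler_wpDl ?sumr_ge0.
have [aJ|Ja] := leqP a (J + m); last first.
  by rewrite [leLHS]big_nat_cond big1 ?sumr_ge0// => i iJ; exfalso; lia.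
rewrite (@big_cat_nat _ _ _ a)//= [X in X + _]big_nat_cond.
rewrite [X in X + _]big1 ?add0r; last first.
  by move=> i ia; exfalso; lia.
rewrite -[X in index_iota X _]add0n big_addn.
rewrite [leRHS](@big_cat_nat _ _ _ (J + m - a)) ?leq_subr//=.
rewrite -[leLHS]addr0 lerD ?sumr_ge0//.
by rewrite big_mkcond ler_sum// => i _; rewrite addnK; case: ifP.
Qed.

Lemma sum_half_pow_le (s N : nat) :
  \sum_(s <= k < N) (2 ^+ k.+1)^-1 <= (2 ^+ s)^-1 :> K.
Proof.
have [sN|Ns] := leqP s N; last by rewrite big_geq ?(ltnW Ns)// invr_ge0 exprn_ge0.
suff -> : \sum_(s <= k < N) (2 ^+ k.+1)^-1 = (2 ^+ s)^-1 - (2 ^+ N)^-1 :> K.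
  by rewrite gerBl invr_ge0 exprn_ge0.
rewrite -opprB -(telescope_sumr (fun k => (2 ^+ k)^-1)) // -sumrN.
apply: eq_bigr => k _; rewrite exprS invfM; field.
by rewrite expf_neq0.
Qed.

(** After [m] shifts, block [k] has l1 norm at most [2 ^+ (m + b k) / 2 ^+ n k], hence at most
    [1 / 2 ^+ k.+1]; summing over [k >= s] gives the bound. The case [s = m = 0] measures the whole
    sequence, the case [s = i.+1], [m = n i] the tail behind block [i]. *)
Lemma superposition_le w b n (s m J : nat) :
  (forall k, \sum_(x <- w k) `|x| <= 2 ^+ b k) ->
  (forall k, (s <= k)%N -> (m + k.+1 + b k <= n k)%N) ->
  \sum_(j < J) `|\sum_(s <= k < (j + m).+1 | (n k <= j + m)%N)
                   2 ^+ m / 2 ^+ n k * (w k)`_(j + m - n k)| <= (2 ^+ s)^-1.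
Proof.
move=> wb nge; apply: le_trans (sum_half_pow_le s (J + m)).
pose F j k := 2 ^+ m / 2 ^+ n k * `|(w k)`_(j + m - n k)|.
have F0 j k : 0 <= F j k by rewrite mulr_ge0// divr_ge0 ?exprn_ge0.
(* The range of [k] is enlarged to one independent of [j], so that the sums can be exchanged. *)
apply: (@le_trans _ _
    (\sum_(j < J) \sum_(s <= k < J + m) if (n k <= j + m)%N then F j k else 0)).
  apply: ler_sum => j _; apply: le_trans (ler_norm_sum _ _ _) _.
  rewrite big_mkcond /=.
  have [sj|js] := leqP s (j + m).+1; last first.
    by rewrite big_geq ?(ltnW js)// sumr_ge0// => k _; case: ifP.
  have jJ : ((j + m).+1 <= J + m)%N by rewrite -addSn leq_add2r.
  rewrite [leRHS](@big_cat_nat _ _ _ (j + m).+1)//= -[leLHS]addr0 lerD//; last first.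
    by apply: sumr_ge0 => k _; case: ifP.
  apply: ler_sum => k _; case: ifP => // _.
  by rewrite normrM ger0_norm// divr_ge0 ?exprn_ge0.
rewrite exchange_big /= !big_nat; apply: ler_sum => k /andP[sk _].
rewrite -big_mkcond /= -mulr_sumr.
apply: (@le_trans _ _ (2 ^+ m / 2 ^+ n k * 2 ^+ b k)).
  rewrite ler_wpM2l ?divr_ge0 ?exprn_ge0//.
  exact: le_trans (sum_nth_shift_le _ _ _ _) (wb k).
rewrite mulrAC -exprD ler_pdivrMr ?exprn_gt0// mulrC ler_pdivlMr ?exprn_gt0// -exprD.
by rewrite ler_eXn2l ?ltr1n// -addnA [(_ + k.+1)%N]addnC addnA nge.
Qed.

(* The sequence is the sum of the 2^(- n k) *: w k, each moved n k steps to the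
   right; the growth of n keeps the blocks disjoint and the tails small. *)
Lemma universal_sequence w b n :
  (forall k, \sum_(x <- w k) `|x| <= 2 ^+ b k) ->
  (forall k, (k.+1 + b k <= n k)%N) ->
  (forall i k, (i < k)%N ->
    (n i + size (w i) <= n k)%N /\ (n i + k.+1 + b k <= n k)%N) ->
  exists u : nat -> K, (forall J, \sum_(j < J) `|u j| <= 1) /\
    forall i J,
      \sum_(j < J) `|2 ^+ n i * u (j + n i)%N - (w i)`_j| <= (2 ^+ i)^-1.
Proof.
move=> wb nge ngrow.
(* Stopping at [k <= j] loses no block, since [n k] exceeds [k]. *)
exists (fun j => \sum_(0 <= k < j.+1 | (n k <= j)%N) (w k)`_(j - n k) / 2 ^+ n k).
split=> [J|i J].
  have := @superposition_le w b n 0 0 J wb (fun k _ => nge k).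
  rewrite expr0 invr1; apply: le_trans; rewrite le_eqVlt; apply/orP; left; apply/eqP.
  apply: eq_bigr => j _; rewrite addn0; congr `|_|; apply: eq_bigr => k _.
  by rewrite mul1r mulrC.
have le1 := @superposition_le w b n i.+1 (n i) J wb (fun k ik => (ngrow i k ik).2).
have le2 : (2 ^+ i.+1)^-1 <= (2 ^+ i)^-1 :> K.
  by rewrite lef_pV2 ?posrE ?exprn_gt0// ler_eXn2l ?ltr1n.
apply: le_trans (le_trans le1 le2); rewrite le_eqVlt; apply/orP; left; apply/eqP.
apply: eq_bigr => j _; congr `|_|.
have ik : (i < (j + n i).+1)%N.
  by move: (nge i); lia.
rewrite (@big_cat_nat _ _ _ i) ?leq0n ?(ltnW ik)//=.
(* Blocks before [i] end at or before position [n i], so they have been shifted out. *)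
rewrite [X in _ * (X + _)]big_nat_cond [X in _ * (X + _)]big1 ?add0r; last first.
  move=> k /andP[/andP[_ ki] _]; have [nk _] := ngrow _ _ ki.
  by rewrite nth_default ?mul0r//; lia.
(* The term [k = i] is exactly the target entry and cancels. *)
rewrite big_ltn_cond// leq_addl addnK mulrDr [_ * (_ / _)]mulrC divfK ?expf_neq0//.
rewrite addrC addKr mulr_sumr; apply: eq_bigr => k _.
by rewrite [RHS]mulrAC mulrA.
Qed.

End universal.

(** * Convex weights from nonnegative combinations of the powers of [mu] *)

Section ground_scalars.
Variables (K : numFieldType) (mu : K).
Hypothesis mu_sum : \sum_(r < 4) mu ^+ r = 0.

Lemma mu_pow4 : mu ^+ 4 = 1.
Proof.
move: mu_sum; rewrite !big_ord_recr big_ord0 /= => mu0.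
apply/eqP; rewrite -subr_eq0 -(mulr0 (mu - 1)) -mu0; apply/eqP; ring.
Qed.

Lemma norm_mu : `|mu| = 1.
Proof. by apply/eqP; rewrite -(@pexpr_eq1 _ _ 4)// -normrX mu_pow4 normr1. Qed.

(* Since 1 + mu + mu^2 + mu^3 = 0, the weights s / 2^(n r) can be added to the
   weights c' r / 2^(n r) representing c without changing the combination; s is
   chosen to make the total weight 1. *)
Lemma convex_weights (c : K) (c' : 'I_4 -> K) (n : 'I_4 -> nat) :
  (forall r, 0 <= c' r) -> c = \sum_(r < 4) c' r * mu ^+ r ->
  (forall r, n r = r %[mod 4]) -> (forall r, \sum_r c' r <= 2 ^+ n r) ->
  exists t : 'I_4 -> K,
    [/\ forall r, 0 <= t r, \sum_r t r = 1 & \sum_r t r * (2 * mu) ^+ n r = c].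
Proof.
move=> c'0 -> nr nge.
have p0 r : 0 < (2 ^+ n r)^-1 :> K by rewrite invr_gt0 exprn_gt0.
pose q := \sum_r (2 ^+ n r)^-1 : K.
have q0 : 0 < q by rewrite /q (bigD1 ord0)//= ltr_pwDl ?sumr_ge0// => r _; rewrite ltW.
pose s := (1 - \sum_r c' r / 2 ^+ n r) / q.
have s0 : 0 <= s.
  rewrite divr_ge0 ?(ltW q0)// subr_ge0.
  (* Each [2 ^+ n r] dominates the sum of the [c'], so the weights [c' r / 2 ^+ n r] add up to at
     most 1; a zero sum is treated apart because the comparison divides by it. *)
  have [C0|C0] := eqVneq (\sum_r c' r) 0.
    rewrite big1 ?ler01// => r _.
    by rewrite (psumr_eq0P _ C0) ?mul0r.
  have C1 : 0 < \sum_r c' r by rewrite lt_def C0 sumr_ge0.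
  apply: (@le_trans _ _ (\sum_r c' r / \sum_r c' r)).
    apply: ler_sum => r _; rewrite ler_wpM2l// lef_pV2 ?posrE ?exprn_gt0//; exact: nge.
  by rewrite -mulr_suml divff.
have mun r : mu ^+ n r = mu ^+ r.
  rewrite (divn_eq (n r) 4) nr (modn_small (ltn_ord r)) exprD mulnC.
  by rewrite exprM mu_pow4 expr1n mul1r.
exists (fun r => c' r / 2 ^+ n r + s / 2 ^+ n r); split.
- by move=> r; rewrite addr_ge0// mulr_ge0// ltW.
- by rewrite big_split/= -mulr_sumr -/q divfK ?gt_eqF// addrC subrK.
- transitivity (\sum_(r < 4) c' r * mu ^+ r + s * \sum_(r < 4) mu ^+ r); last first.
    by rewrite mu_sum mulr0 addr0.
  rewrite mulr_sumr -big_split /=.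
  apply: eq_bigr => r _; rewrite exprMn mun mulrDl !mulrA !divfK//;
  by rewrite expf_neq0// pnatr_eq0.
Qed.

End ground_scalars.

(** * Sequence spaces treated abstractly *)

(** This interface lets one construction serve c_0 and all the l^p. [l1_extend] is the contractive
    inclusion of l^1: it both creates vectors and bounds norms. *)
Record sequence_space (K : numFieldType) (X : normedModType K)
    (entry : X -> nat -> K) (B : X -> X) : Prop := SequenceSpace {
  entry_linear : forall (a : K) x y j, entry (a *: x + y) j = a * entry x j + entry y j;
  entry_inj : forall x y, entry x =1 entry y -> x = y;
  entry_le_norm : forall x j, `|entry x j| <= `|x|;
  entry_shift : forall x j, entry (B x) j = entry x j.+1;
  norm_shift_le : forall x, `|B x| <= `|x|;
  l1_extend : forall (u : nat -> K) M, (forall J, \sum_(j < J) `|u j| <= M) ->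
    exists2 x, entry x =1 u & `|x| <= M;
  finite_dense : forall x (e : K), 0 < e -> exists N x',
    (forall j, (N <= j)%N -> entry x' j = 0) /\ `|x - x'| < e }.

Section sequence_space_theory.
Variables (K : numFieldType) (X : normedModType K).
Variables (entry : X -> nat -> K) (B : X -> X).
Hypothesis sp : sequence_space entry B.

Lemma entry0 j : entry 0 j = 0.
Proof.
have := entry_linear sp 1 0 0 j; rewrite scale1r addr0 mul1r => /eqP.
by rewrite addrC -subr_eq subrr => /eqP/esym.
Qed.

Lemma entryD x y j : entry (x + y) j = entry x j + entry y j.
Proof. by have := entry_linear sp 1 x y j; rewrite scale1r mul1r. Qed.

Lemma entryZ a x j : entry (a *: x) j = a * entry x j.
Proof. by have := entry_linear sp a x 0 j; rewrite !addr0 entry0 addr0. Qed.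

Lemma entryB x y j : entry (x - y) j = entry x j - entry y j.
Proof. by rewrite entryD -scaleN1r entryZ mulN1r. Qed.

Lemma norm_le_l1 x M : (forall J, \sum_(j < J) `|entry x j| <= M) -> `|x| <= M.
Proof. by move=> /(l1_extend sp)[y xy] yM; rewrite -(entry_inj sp xy). Qed.

Lemma unit_vector : exists2 e : X, (forall j, entry e j = (j == 0%N)%:R) & `|e| <= 1.
Proof.
apply: (l1_extend sp (u := fun j => (j == 0%N)%:R)) => -[|J].
  by rewrite big_ord0.
by rewrite big_ord_recl/= normr1 big1 ?addr0// => i _; rewrite normr0.
Qed.

(** Truncate [x] to finite support within [e / 2], then round coordinate [j] to within
    [e / 2 / 2 ^+ j.+1]; the l1 norm controls the total rounding error. Words over a countable [T]
    thus give a countable family of targets. *)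
Lemma sequence_approx (T : Type) (d : T -> K) (x : X) (e : K) :
  (forall c (e : K), 0 < e -> exists q, `|c - d q| < e) -> 0 < e ->
  exists s : seq T, forall y, (forall j, entry y j = (map d s)`_j) -> `|x - y| < e.
Proof.
move=> dense_d e0.
have [N [x' [x'N xx']]] := finite_dense sp x (divr_gt0 e0 (ltr0Sn K 1)).
pose h j := e / 2 / 2 ^+ j.+1.
have h0 j : 0 < h j by rewrite !divr_gt0// exprn_gt0.
have [q qh] := choice (fun j => dense_d (entry x' j) (h j) (h0 j)).
exists (map q (iota 0 N)) => y yE.
rewrite [ltRHS](splitr e) -(subrKA x') (le_lt_trans (ler_normD _ _))// ltr_leD//.
apply: norm_le_l1 => J.
apply: (@le_trans _ _ (\sum_(j < J) h j)).
  apply: ler_sum => j _; rewrite entryB yE; have [jN|Nj] := ltnP j N.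
    by rewrite -map_comp (nth_map 0%N) ?size_iota// nth_iota// ltW.
  by rewrite x'N// nth_default ?size_map ?size_iota// subrr normr0 ltW.
rewrite -mulr_sumr ger_pMr ?divr_gt0//.
by have := sum_half_pow_le K 0 J; rewrite expr0 invr1 big_mkord.
Qed.

End sequence_space_theory.

(** * Weak continuity of bounded functionals *)

(** The supremum topology is finer than each initial topology, where such a preimage is open by
    construction. *)
Lemma open_preimage_weak (K : numFieldType) (X : normedModType K)
    (f : topological_dual X) (A : set K^o) :
  open A -> open (sval f @^-1` A : set (weak_topology X)).
Proof.
move=> oA; rewrite openE => x Ax.
apply: ((@cvg_sup X _ (fun f : topological_dual X =>
    Topological.class (initial_topology (sval f : X -> K^o)))
    (nbhs (x : weak_topology X)) x _).1 (fun A => id) f).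
apply: open_nbhs_nbhs; split => //.
by exists A.
Qed.

(** * The operator on the direct sum and its dynamics *)

Section model_operator.
Variables (K : numFieldType) (X : normedModType K).
Variables (entry : X -> nat -> K) (B : X -> X) (e : X) (mu : K).
Hypothesis sp : sequence_space entry B.
Hypothesis e_entry : forall j, entry e j = (j == 0%N)%:R.
Hypothesis e_norm : `|e| <= 1.
Hypothesis mu_sum : \sum_(r < 4) mu ^+ r = 0.

(* The correction along e turns evaluation at 0 of the first component into an
   eigenvector of the adjoint, for the eigenvalue 2 * mu. *)
Definition model_op (z : X * X) : X * X :=
  (2 *: B z.1 + (2 * mu * entry z.1 0 - 2 * entry z.1 1) *: e, 2 *: B z.2).

Lemma model_op_linear : linear model_op.
Proof.
move=> a [x x'] [y y']; congr pair; apply: (entry_inj sp) => j /=;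
  rewrite !(entryD sp, entryZ sp, entry_shift sp); ring.
Qed.

Lemma model_op_bounded : bounded_operator model_op.
Proof.
(* In the first component the shift costs 2 and each of the two terms in the coefficient of [e]
   costs 2, as [mu] has modulus 1. *)
exists (2 + (2 + 2)) => -[x y].
have comp (a b c : X) : c \in [:: a; b] -> `|c| <= `|(a, b)|.
  rewrite prod_normE/= !inE => /orP[]/eqP->.
    by rewrite comparable_le_max ?lexx// real_comparable.
  by rewrite comparable_le_max ?lexx ?orbT// real_comparable.
have xz : `|x| <= `|(x, y)| by apply: comp; rewrite inE eqxx.
have yz : `|y| <= `|(x, y)| by apply: comp; rewrite !inE eqxx orbT.
rewrite [leLHS]prod_normE comparable_ge_max ?real_comparable//=; apply/andP; split.
  apply: le_trans (ler_normD _ _) _; rewrite [leRHS]mulrDl; apply: lerD.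
    rewrite normrZ ger0_norm// ler_wpM2l// (le_trans (norm_shift_le sp _))//.
  rewrite normrZ -[leRHS]mulr1 ler_pM// [leRHS]mulrDl.
  apply: le_trans (ler_normB _ _) _; rewrite !normrM (norm_mu mu_sum) mulr1 normr_nat.
  by rewrite lerD// ler_wpM2l// (le_trans (entry_le_norm sp _ _)).
rewrite normrZ ger0_norm// ler_pM// ?lerDl// (le_trans (norm_shift_le sp _))//.
Qed.

Lemma entry_iter0 n z : entry (iter n model_op z).1 0 = (2 * mu) ^+ n * entry z.1 0.
Proof.
elim: n => [|n IH]; first by rewrite mul1r.
rewrite iterS /= !(entryD sp, entryZ sp, entry_shift sp) e_entry IH exprS eqxx mulr1.
ring.
Qed.

(** The correction along [e] touches only coordinate 0, so the other coordinates evolve under the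
    doubled shift alone. *)
Lemma entry_iter1 n z j :
  entry (iter n model_op z).1 j.+1 = 2 ^+ n * entry z.1 (j + n).+1.
Proof.
elim: n j => [|n IH] j; first by rewrite mul1r addn0.
rewrite iterS /= !(entryD sp, entryZ sp, entry_shift sp) e_entry IH mulr0 addr0.
by rewrite exprS mulrA addSnnS.
Qed.

Lemma entry_iter2 n z j : entry (iter n model_op z).2 j = 2 ^+ n * entry z.2 (j + n).
Proof.
elim: n j => [|n IH] j; first by rewrite mul1r addn0.
by rewrite iterS /= (entryZ sp) (entry_shift sp) IH exprS mulrA addSnnS.
Qed.

(** Weak density would make the numbers [(2 * mu) ^+ n * c] dense, where [c] is coordinate 0 of
    [z.1]. If [c = 0] they stay away from 1; otherwise their moduli are at least that of [c], so
    they stay away from 0. *)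
Lemma not_weakly_hypercyclic_model_op : ~ weakly_hypercyclic model_op.
Proof.
move=> [z zdense].
pose f := fun z : (X * X)%type => entry z.1 0 : K^o.
have f_lin : linear f by move=> a x y; exact: entry_linear sp a x.1 y.1 0%N.
pose f' : {linear (X * X)%type -> K^o} :=
  HB.pack f (GRing.isLinear.Build _ _ _ _ f f_lin).
have f_bounded : bounded_operator (f' : (X * X)%type -> K^o).
  exists 1 => x; rewrite mul1r (le_trans (entry_le_norm sp _ _))//.
  by rewrite prod_normE comparable_le_max ?lexx// real_comparable.
have disj (c a : K) : 0 < a -> exists n, `|c - (2 * mu) ^+ n * entry z.1 0| < a.
  move=> a0.
  have oU := @open_preimage_weak _ _ (exist _ f' f_bounded) _
    (open_interior (ball (c : K^o) a)).
  have [|w [/interior_subset wa [n _ wE]]] := zdense _ _ oU.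
    exists (c *: e, 0); rewrite /preimage /= /f /= (entryZ sp) e_entry mulr1.
    exact: nbhsx_ballx.
  by exists n; rewrite -entry_iter0 wE; move: wa; rewrite -ball_normE.
have [z0|z0] := eqVneq (entry z.1 0) 0.
  have [n] := disj 1 1 ltr01.
  by rewrite z0 mulr0 subr0 normr1 ltxx.
have [|n] := disj 0 `|entry z.1 0|; first by rewrite normr_gt0.
rewrite sub0r normrN normrM normrX normrM (norm_mu mu_sum) mulr1 normr_nat.
by rewrite gtr_pMl ?normr_gt0// => /lt_geF; rewrite exprn_ege1// ler1n.
Qed.

Lemma not_convex_cyclic_sqr_model_op :
  (forall n (t : 'I_n -> K) (k : 'I_n -> nat), (forall i, 0 <= t i) ->
     1 <= `|\sum_i t i * (mu ^+ 2) ^+ k i - mu|) ->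
  ~ convex_cyclic (model_op \o model_op).
Proof.
move=> far [z zdense].
have disj (c a : K) : 0 < a -> exists n (t : 'I_n -> K) (k : 'I_n -> nat),
    (forall i, 0 <= t i) /\
    `|c - (\sum_i t i * (mu ^+ 2) ^+ k i) * entry z.1 0| < a.
  move=> a0.
  have [|v [/interior_subset vc [n [t [b [t0 t1 bz vE]]]]]] :=
    zdense _ _ (open_interior (ball ((c *: e, 0) : (X * X)%type) a)).
    by exists (c *: e, 0); exact: nbhsx_ballx.
  have {bz}/choice[k bk] : forall i, exists k, b i = iter k (model_op \o model_op) z.
    by move=> i; have [k _ <-] := bz i; exists k.
  have iter2 k' : iter k' (model_op \o model_op) z = iter (2 * k') model_op z.
    by elim: k' => [//|k' IH]; rewrite mulnS !iterS IH.
  (* Here [(2 * mu) ^+ (2 * k)] is [4 ^+ k * (mu ^+ 2) ^+ k]; the factor [4 ^+ k] goes into the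
     coefficients, which [far] takes as arbitrary nonnegative numbers. *)
  exists n, (fun i => t i * 4 ^+ k i), k; split.
    by move=> i; rewrite mulr_ge0// exprn_ge0.
  have -> : (\sum_i t i * 4 ^+ k i * (mu ^+ 2) ^+ k i) * entry z.1 0 = entry v.1 0.
    rewrite vE raddf_sum /=.
    rewrite (big_morph _ (fun x y => entryD sp x y 0) (entry0 sp 0)) mulr_suml.
    apply: eq_bigr => i _; rewrite bk iter2 (entryZ sp) entry_iter0.
    by rewrite (natrM K 2 2) exprM !exprMn; ring.
  have -> : c = entry (c *: e) 0 by rewrite (entryZ sp) e_entry mulr1.
  rewrite -(entryB sp); apply: le_lt_trans (entry_le_norm sp _ _) _.
  by case: vc => /=; rewrite -ball_normE.
have [z0|z0] := eqVneq (entry z.1 0) 0.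
  have [n [t [k [_]]]] := disj 1 1 ltr01.
  by rewrite z0 mulr0 subr0 normr1 ltxx.
have [|n [t [k [t0]]]] := disj (mu * entry z.1 0) `|entry z.1 0|.
  by rewrite normr_gt0.
by rewrite -mulrBl normrM gtr_pMl ?normr_gt0// distrC => /lt_geF; rewrite far.
Qed.

Lemma norm_convex_comb_le (Y : normedModType K) m
    (t : 'I_m -> K) (g : 'I_m -> Y) (a : K) :
  (forall r, 0 <= t r) -> \sum_r t r = 1 -> (forall r, `|g r| <= a) ->
  `|\sum_r t r *: g r| <= a.
Proof.
move=> t0 t1 ga; rewrite -[leRHS]mul1r -t1 mulr_suml.
apply: le_trans (ler_norm_sum _ _ _) _; apply: ler_sum => r _.
by rewrite normrZ ger0_norm// ler_wpM2l.
Qed.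

(** All pairs of words, with a residue mod 4, are enumerated and encoded in one vector. For a given
    target, four orbit points with the four residues approximate it off coordinate 0, and
    [convex_weights] then adjusts coordinate 0 without spoiling the rest. *)
Lemma convex_cyclic_model_op (T : countType) (d : T -> K) :
  (forall c (a : K), 0 < a -> exists q, `|c - d q| < a) ->
  (forall x : K, exists L, `|x| <= 2 ^+ L) ->
  (forall c : K, exists c' : 'I_4 -> K,
    (forall r, 0 <= c' r) /\ c = \sum_(r < 4) c' r * mu ^+ r) ->
  convex_cyclic model_op.
Proof.
move=> dense_d arch cone.
(* The [nat] component is a free label giving each triple of residue and words infinitely many
   codes. The default covers numbers that are not codes; only genuine codes are selected later. *)
pose D k : nat * 'I_4 * seq T * seq T := odflt (0%N, ord0, [::], [::]) (unpickle k).
(* The head is dropped in the first component because coordinate 0 follows the powers of [2 * mu],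
   not the shift. *)
pose w1 k := behead (map d (D k).1.2); pose w2 k := map d (D k).2.
have /choice[b bP] : forall k, exists b,
    \sum_(x <- w1 k) `|x| <= 2 ^+ b /\ \sum_(x <- w2 k) `|x| <= 2 ^+ b.
  move=> k; have [b1 b1P] := arch (\sum_(x <- w1 k) `|x|).
  have [b2 b2P] := arch (\sum_(x <- w2 k) `|x|).
  rewrite !ger0_norm ?sumr_ge0// in b1P b2P.
  exists (maxn b1 b2); split; [apply: le_trans b1P _|apply: le_trans b2P _];
    by rewrite ler_eXn2l ?ltr1n ?leq_maxl ?leq_maxr.
have [n [n_mod n_ge n_grow]] := sparse_exponents b
  (fun k => maxn (size (w1 k)) (size (w2 k))) (fun k => (D k).1.1.2).
have [|u1 [u1_l1 u1P]] := universal_sequence (fun k => (bP k).1) n_ge.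
  by move=> i k /n_grow[+ ->]; split => //; lia.
have [|u2 [u2_l1 u2P]] := universal_sequence (fun k => (bP k).2) n_ge.
  by move=> i k /n_grow[+ ->]; split => //; lia.
have [|x0 x0E _] := l1_extend sp
  (u := fun j => if j is j'.+1 then u1 j' else 1) (M := 1 + 1).
  by case=> [|J]; rewrite ?big_ord0// big_ord_recl normr1 lerD2l; exact: u1_l1.
have [y0 y0E _] := l1_extend sp u2_l1.
exists (x0, y0) => O [[a c] Oac] oO.
have /nbhs_ballP[eps /= eps0 epsO] : nbhs (a, c) O by exact: open_nbhs_nbhs.
(* In the first component, one third each goes to replacing [a] by [xs], to the resulting
   discrepancy at coordinate 0, and to the orbit error. *)
pose dl := eps / 3; have dl0 : 0 < dl by rewrite divr_gt0.
have [s sP] := sequence_approx sp a dense_d dl0.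
have [s' s'P] := sequence_approx sp c dense_d dl0.
have [xs xsE _] := l1_extend sp (sum_nth_le (map d s)).
have [ys ysE _] := l1_extend sp (sum_nth_le (map d s')).
have [c' [c'0 c'E]] := cone (entry a 0).
(* Codes beyond [L] make the orbit error at most [dl]; codes beyond [M] meet the size condition of
   [convex_weights]. *)
have [L LP] := arch dl^-1; have [M MP] := arch (\sum_r c' r).
have unbounded (r : 'I_4) : exists j : nat, (maxn L M <= pickle (j, r, s, s'))%N.
  apply: (@injective_unbounded (fun j => pickle (j, r, s, s'))) => j1 j2.
  by move=> /(pcan_inj pickleK)[].
have [j jP] := choice unbounded.
pose k r := pickle (j r, r, s, s').
have Dk r : D (k r) = (j r, r, s, s') by rewrite /D /k pickleK.
have kn r : (k r <= n (k r))%N by move: (n_ge (k r)); lia.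
have dlk r : (2 ^+ k r)^-1 <= dl.
  rewrite -[dl]invrK lef_pV2 ?posrE ?exprn_gt0 ?invr_gt0//.
  have := jP r; rewrite geq_max -/(k r) => /andP[Lk _].
  rewrite -[leLHS]ger0_norm ?invr_ge0 ?(ltW dl0)// (le_trans LP)//.
  by rewrite ler_eXn2l ?ltr1n.
have [|r|t [t0 t1 tE]] := convex_weights mu_sum c'0 c'E (n := n \o k).
- by move=> r; rewrite /= n_mod Dk.
- have := jP r; rewrite geq_max -/(k r) => /andP[_ Mk].
  rewrite -[leLHS]ger0_norm ?sumr_ge0// (le_trans MP)//.
  by rewrite ler_eXn2l ?ltr1n// (leq_trans Mk)// kn.
pose z r := iter (n (k r)) model_op (x0, y0).
exists (\sum_r t r *: z r); split; last first.
  by exists 4%N, t, z; split=> // r; exists (n (k r)).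
(* The orbit error with coordinate 0 removed from both the orbit point and [xs]; its own coordinate
   0 is 0. *)
pose g1 r := (z r).1 - (2 * mu) ^+ n (k r) *: e - (xs - entry xs 0 *: e).
pose g2 r := (z r).2 - ys.
have g1_le r : `|g1 r| <= dl.
  apply: (norm_le_l1 sp) => -[|J]; first by rewrite big_ord0 ltW.
  rewrite big_ord_recl !(entryB sp, entryZ sp) entry_iter0 e_entry x0E !mulr1.
  rewrite !subrr normr0 add0r; apply: le_trans (dlk r).
  apply: le_trans (u1P (k r) J); apply: ler_sum => i _.
  rewrite !(entryB sp, entryZ sp) [entry (z r).1 _]entry_iter1 e_entry x0E xsE /=.
  by rewrite !mulr0 !subr0 /w1 Dk nth_behead.
have g2_le r : `|g2 r| <= dl.
  apply: (norm_le_l1 sp) => J; apply: le_trans (dlk r).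
  apply: le_trans (u2P (k r) J); apply: ler_sum => i _.
  by rewrite (entryB sp) [entry (z r).2 _]entry_iter2 y0E ysE /w2 Dk.
have dl3 : eps = dl + dl + dl by rewrite /dl; field.
apply: epsO; rewrite /ball /= /prod_ball /= -ball_normE /ball_ /= dl3.
have -> : (\sum_r t r *: z r).1 = \sum_r t r *: (z r).1 by rewrite raddf_sum.
have -> : (\sum_r t r *: z r).2 = \sum_r t r *: (z r).2 by rewrite raddf_sum.
split.
  (* Averaging the [g1 r] with weights [t r] turns the multiples of [e] into [entry a 0 *: e], so
     only the discrepancy between [a] and [xs] remains at coordinate 0. *)
  have -> : a - \sum_r t r *: (z r).1 =
      (a - xs) - entry (a - xs) 0 *: e - \sum_r t r *: g1 r.
    have -> : \sum_r t r *: g1 r =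
        \sum_r t r *: (z r).1 - entry a 0 *: e - (xs - entry xs 0 *: e).
      under eq_bigr do rewrite 2!scalerBr scalerA.
      by rewrite 2!sumrB -!scaler_suml tE t1 scale1r.
    rewrite (entryB sp) scalerBl; move: (\sum_r _) (_ *: e) (_ *: e) => v p q.
    by rewrite -(addrA a) -opprD addrCA -(addrA v) -opprD opprB subrKA.
  have axs := sP xs xsE.
  apply: le_lt_trans (ler_normB _ _) _; rewrite ltr_leD ?norm_convex_comb_le//.
  apply: le_lt_trans (ler_normB _ _) _; rewrite ltr_leD//.
  rewrite normrZ -[leRHS]mulr1 ler_pM// ltW//.
  exact: le_lt_trans (entry_le_norm sp _ _) axs.
have -> : c - \sum_r t r *: (z r).2 = (c - ys) - \sum_r t r *: g2 r.
  under [in RHS]eq_bigr do rewrite scalerBr.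
  by rewrite sumrB -scaler_suml t1 scale1r opprB addrA subrK.
apply: le_lt_trans (ler_normB _ _) _; rewrite ltr_leD ?norm_convex_comb_le//.
by rewrite ltr_wpDr ?(ltW dl0)// s'P.
Qed.

End model_operator.

(** * Density, growth and the choice of [mu] for real and complex scalars *)

Section ground_facts.
Variables (R : realType) (F : ground).
Local Notation K := (ground_field R F).

Lemma ground_archimedean (x : K) : exists L, `|x| <= 2 ^+ L.
Proof.
have [L xL] : exists L, modulus x <= 2 ^+ L.
  exists (Num.bound (modulus x)); have := archi_boundP (modulus_ge0 x).
  by move=> /ltW/le_trans; apply; rewrite -natrX ler_nat ltnW// ltn_expl.
exists L; rewrite -of_real_modulus.
have -> : 2 ^+ L = of_real F (2 ^+ L) :> K; last by rewrite of_real_le.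
by case: F => //=; rewrite rmorphXn/= rmorph_nat.
Qed.

(** Rationals over the reals, Gaussian rationals over the complex numbers. *)
Lemma ground_dense :
  exists d : rat * rat -> K, forall c (a : K), 0 < a -> exists q, `|c - d q| < a.
Proof.
have rat_approx (x a : R) : 0 < a -> exists q : rat, `|x - ratr q| < a.
  move=> a0; have /rat_in_itvoo[q] : x - a < x + a by rewrite ltrD2l gtrN.
  by rewrite in_itv/= => xq; exists q; rewrite distrC ltr_distl.
case: F => /=.
  by exists (fun q => ratr q.1) => c a /(rat_approx c)[q cq]; exists (q, 0).
exists (fun q => (ratr q.1 +i* ratr q.2)%C) => -[x y] a a0.
(* Positivity in the order of [R[i]] forces the imaginary part to vanish. *)
have [b b0 ab] : exists2 b : R, 0 < b & a = b%:C%C.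
  by case: a a0 => b b'; rewrite ltcE/= => /andP[/eqP-> b0]; exists b.
have [q xq] := rat_approx x _ (divr_gt0 b0 (ltr0Sn R 1)).
have [q' yq] := rat_approx y _ (divr_gt0 b0 (ltr0Sn R 1)).
exists (q, q'); rewrite ab.
have -> : (x +i* y)%C - (ratr q +i* ratr q')%C =
    (x - ratr q)%:C%C + 'i%C * (y - ratr q')%:C%C.
  by apply/eqP; rewrite eq_complex/=; apply/andP; split; apply/eqP; ring.
apply: le_lt_trans (ler_normD _ _) _;
rewrite normrM !normc_def /= !expr0n /= !addr0 add0r expr1n sqrtr1 mul1r !sqrtr_sqr.
by rewrite -rmorphD ltcR [ltRHS]splitr ltrD.
Qed.

(** Positive and negative parts give the cone property for -1 and for i. With [mu = -1] the sums in
    the last clause are nonnegative, so at distance at least 1 from -1; with [mu = i] they are real,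
    so at distance at least 1 from i. *)
Lemma ground_root : exists mu : K, [/\ \sum_(r < 4) mu ^+ r = 0,
  forall c : K, exists c' : 'I_4 -> K,
    (forall r, 0 <= c' r) /\ c = \sum_(r < 4) c' r * mu ^+ r &
  forall n (t : 'I_n -> K) (k : 'I_n -> nat), (forall i, 0 <= t i) ->
    1 <= `|\sum_i t i * (mu ^+ 2) ^+ k i - mu|].
Proof.
case: F => /=.
  exists (-1); split.
  - by rewrite !big_ord_recr big_ord0 /=; ring.
  - move=> c; exists (fun r => match val r with
      | 0 => Num.max c 0 | 1 => Num.max (- c) 0 | _ => 0 end).
    split=> [[[|[|r]] ?]|] /=; rewrite ?le_max ?lexx ?orbT//.
    rewrite !big_ord_recr big_ord0 /=.
    have cE : c = Num.max c 0 - Num.max (- c) 0.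
      rewrite /Num.max oppr_lt0; case: ltgtP => //=; lra.
    by rewrite {1}cE; ring.
  - move=> n t k t0; rewrite opprK sqrrN expr1n.
    have s0 : 0 <= \sum_i t i * 1 ^+ k i.
      by apply: sumr_ge0 => i _; rewrite expr1n mulr1.
    by rewrite ger0_norm ?lerDr// addr_ge0.
exists 'i%C; split.
- apply/eqP; rewrite !big_ord_recr big_ord0 /= eq_complex/=.
  by apply/andP; split; apply/eqP; ring.
- move=> [x y].
  exists (fun r => match val r with 0 => (Num.max x 0)%:C%C | 1 => (Num.max y 0)%:C%C
    | 2 => (Num.max (- x) 0)%:C%C | _ => (Num.max (- y) 0)%:C%C end).
  split=> [[[|[|[|r]]] ?]|] /=; rewrite ?lecR ?le_max ?lexx ?orbT//.
  have xE (u : R) : u = Num.max u 0 - Num.max (- u) 0.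
    by rewrite /Num.max oppr_lt0; case: ltgtP => //=; lra.
  rewrite !big_ord_recr big_ord0 /=.
  rewrite {1}(xE x) {1}(xE y).
  by apply/eqP; rewrite eq_complex/=; apply/andP; split; apply/eqP; ring.
- move=> n t k t0; rewrite sqr_i.
  have /complex_realP[u ->] : \sum_i t i * (-1) ^+ k i \is @Num.real R[i].
    by apply: rpred_sum => i _; rewrite rpredM ?rpredX ?rpredN ?rpred1 ?ger0_real.
  rewrite normc_def /= sub0r sqrrN expr1n subr0 lecR -[leLHS]sqrtr1 ler_wsqrtr//.
  by rewrite lerDr sqr_ge0.
Qed.

End ground_facts.

(** * Real-valued estimates for sums and scalars *)

(** A partial sum within [e] of the supremum leaves at most [e] for all later terms. *)
Lemma partial_sums_tail (R : realType) (v : nat -> R) (M e : R) :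
  (forall j, 0 <= v j) -> (forall J, \sum_(j < J) v j <= M) -> 0 < e ->
  exists N, forall J, \sum_(N <= j < J) v j <= e.
Proof.
move=> v0 vM e0; pose S := range (fun J => \sum_(j < J) v j).
have supS : has_sup S.
  by split; [exists (\sum_(j < 0) v j), 0%N|exists M => _ [J _ <-]].
have [_ [N _ <-] Ne] := sup_adherent e0 supS.
exists N => J; have [JN|/ltnW NJ] := leqP J N; first by rewrite big_geq ?ltW.
have : \sum_(j < J) v j <= sup S by apply: sup_upper_bound => //; exists J.
rewrite -(big_mkord xpredT v) (@big_cat_nat _ _ _ N)//= big_mkord.
by move: Ne; rewrite -/S; lra.
Qed.

(** The empty sum forces [0 <= M], so [M] is real and the bound can be read in [R]. *)
Lemma sum_modulus_le (R : realType) (F : ground) (u : nat -> ground_field R F)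
    (M : ground_field R F) :
  (forall J, \sum_(j < J) `|u j| <= M) ->
  M = of_real F (modulus M) /\ forall J, \sum_(j < J) modulus (u j) <= modulus M.
Proof.
move=> uM; have M0 : 0 <= M by have := uM 0%N; rewrite big_ord0.
have ME : M = of_real F (modulus M) by rewrite of_real_modulus ger0_norm.
split=> // J; rewrite -(of_real_le F) -ME (big_morph _ (@of_realD R F) (of_real0 R F)).
by under eq_bigr do rewrite of_real_modulus.
Qed.

Lemma of_real_lt (R : realType) (F : ground) (a b : R) :
  (of_real F a < of_real F b) = (a < b).
Proof. by rewrite !lt_neqAle of_real_le (inj_eq (@of_real_inj R F)). Qed.

Lemma gt0_of_real (R : realType) (F : ground) (e : ground_field R F) :
  0 < e -> exists2 a : R, 0 < a & e = of_real F a.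
Proof.
move=> e0; have eE : e = of_real F (modulus e) by rewrite of_real_modulus gtr0_norm.
by exists (modulus e) => //; rewrite -(of_real_lt F) -eE of_real0.
Qed.

(** * c_0 as a sequence space *)

Section c0_instance.
Variables (R : realType) (F : ground).
Local Notation K := (ground_field R F).
Local Notation c0 := (c0_space R F).

Lemma c0_norm_le (x : c0) (M : R) :
  (forall n, modulus (x n) <= M) -> `|x| <= of_real F M.
Proof.
move=> xM; rewrite [`|x|]/(c0_norm x) /c0_norm of_real_le ge_sup//.
  by case: (c0_has_sup x).
by move=> _ [n _ <-].
Qed.

Lemma c0_null (u : nat -> K^o) :
  (forall e : R, 0 < e -> exists N, forall n, (N <= n)%N -> modulus (u n) <= e) ->
  u \in @c0_pred R F.
Proof.
move=> u0; apply/asboolP/cvgrPdist_le => e e0.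
have [a a0 ->] := gt0_of_real e0; have [N uN] := u0 _ a0.
by exists N => // n /uN; rewrite sub0r normrN -of_real_modulus of_real_le.
Qed.

Lemma c0_nullP (x : c0) (e : R) : 0 < e ->
  exists N, forall n, (N <= n)%N -> modulus (x n) <= e.
Proof.
move=> e0; have /asboolP/cvgrPdist_le := c0_valP x.
move=> /(_ (of_real F e))[]; first by rewrite -(of_real0 R F) of_real_lt.
move=> N _ xN; exists N => n /xN.
by rewrite sub0r normrN -of_real_modulus of_real_le.
Qed.

Lemma c0_sequence_space : exists B : c0 -> c0,
  sequence_space (fun (x : c0) j => (x : nat -> K^o) j : K) B.
Proof.
have shift_null (x : c0) : (fun n => x n.+1) \in @c0_pred R F.
  apply: c0_null => e /(c0_nullP x)[N xN].
  by exists N => n Nn; apply: xN; exact: leqW.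
have le_norm (x : c0) j : `|(x : nat -> K^o) j : K| <= `|x|.
  by rewrite -of_real_modulus of_real_le c0_modulus_le.
exists (fun x => C0 (shift_null x)); split=> //.
- by move=> x y xy; apply/val_inj/funext.
- move=> x; rewrite [leRHS]/(c0_norm x); apply: c0_norm_le => n.
  exact: (c0_modulus_le x n.+1).
- move=> u M /sum_modulus_le[ME uM].
  have le1 j J : (j < J)%N -> modulus (u j) <= \sum_(i < J) modulus (u i).
    move=> jJ; rewrite (bigD1 (Ordinal jJ))//= lerDl sumr_ge0// => i _.
    exact: modulus_ge0.
  have u0 : (u : nat -> K^o) \in @c0_pred R F.
    apply: c0_null => e e0.
    have [N uN] := partial_sums_tail (fun j => modulus_ge0 (u j)) uM e0.
    exists N => n Nn; apply: le_trans (uN n.+1).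
    rewrite big_nat_recr//= lerDr sumr_ge0// => i _; exact: modulus_ge0.
  exists (C0 u0) => //; rewrite ME; apply: c0_norm_le => n /=.
  by apply: le_trans (uM n.+1); exact: le1.
- move=> x e e0.
  have [a a0 ->] := gt0_of_real e0.
  have [N xN] := c0_nullP x (divr_gt0 a0 (ltr0Sn R 1)).
  have x'0 : (fun n => if (n < N)%N then x n else 0) \in @c0_pred R F.
    by apply: c0_null => b b0; exists N => n Nn; rewrite ltnNge Nn modulus0 ltW.
  exists N, (C0 x'0); split=> [j Nj /=|]; first by rewrite ltnNge Nj.
  apply: (@le_lt_trans _ _ (of_real F (a / 2))); last first.
    by rewrite of_real_lt; lra.
  apply: c0_norm_le => n.
  have -> : (x - C0 x'0) n = x n - (if (n < N)%N then x n else 0) by [].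
  case: ltnP => [_|/xN]; last by rewrite subr0.
  by rewrite subrr modulus0 divr_ge0// ltW.
Qed.

End c0_instance.

(** * l^p as a sequence space *)

Section lp_instance.
Variables (R : realType) (F : ground) (p : R) (p1 : 1 <= p).
Local Notation K := (ground_field R F).
Local Notation lp := (lp_space F p1).

Let p_gt0 : 0 < p. Proof. exact: lt_le_trans p1. Qed.

(** This trades the extended-real norm for finite real sums, in which the remaining estimates are
    made. *)
Lemma lp_enorm_le (u : nat -> K^o) (M : R) : 0 <= M ->
  (lp_enorm p u <= M%:E)%E <-> forall J, \sum_(j < J) modulus (u j) `^ p <= M `^ p.
Proof.
move=> M0.
have mp0 j : (0 <= (modulus (u j) `^ p)%:E)%E by rewrite lee_fin powR_ge0.
have pK (a : R) : 0 <= a -> (a `^ p) `^ p^-1 = a.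
  by move=> a0; rewrite -powRrM mulfV ?gt_eqF// powRr1.
have pV0 : 0 <= p^-1 by rewrite invr_ge0 ltW.
have sumE J : ((\sum_(j < J) modulus (u j) `^ p)%:E =
    \sum_(0 <= j < J) (modulus (u j) `^ p)%:E)%E.
  by rewrite big_mkord sumEFin.
have sum0 : (0 <= \sum_(j <oo) (modulus (u j) `^ p)%:E)%E by exact: nneseries_ge0.
rewrite lp_enormE//; split=> [uM J|uM].
  rewrite leNgt; apply/negP => MJ.
  have : M < (\sum_(j < J) modulus (u j) `^ p) `^ p^-1.
    rewrite -[ltLHS]pK// gt0_ltr_powR ?invr_gt0 ?nnegrE ?powR_ge0 ?sumr_ge0// => i _.
    exact: powR_ge0.
  apply/negP; rewrite -leNgt -lee_fin; apply: le_trans uM.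
  rewrite -poweR_EFin; apply: gt0_ler_poweR; rewrite ?in_itv/= ?sum0 ?leey//.
    by rewrite sumE sume_ge0.
  by rewrite sumE; exact: nneseries_lim_ge.
have -> : M%:E = (((M `^ p)%:E) `^ p^-1)%E by rewrite poweR_EFin pK.
apply: gt0_ler_poweR; rewrite ?in_itv/= ?sum0 ?leey ?lee_fin ?powR_ge0//.
apply: lime_le; first exact: is_cvg_nneseries.
by apply: nearW => J; rewrite -sumE lee_fin.
Qed.

Lemma lp_norm_le (x : lp) (M : R) : 0 <= M ->
  (forall J, \sum_(j < J) modulus (x j) `^ p <= M `^ p) -> `|x| <= of_real F M.
Proof.
move=> M0 xM; rewrite [`|x|]/(lp_norm x) of_real_le -lee_fin fineK ?lp_enorm_fin//.
exact/lp_enorm_le.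
Qed.

Lemma lp_sum_le (x : lp) :
  exists2 M : R, `|x| = of_real F M /\ 0 <= M &
    forall J, \sum_(j < J) modulus (x j) `^ p <= M `^ p.
Proof.
exists (fine (lp_enorm p x)); first by split=> //; rewrite fine_ge0// lp_enorm_ge0.
by apply/lp_enorm_le; rewrite ?fine_ge0 ?lp_enorm_ge0// fineK// lp_enorm_fin.
Qed.

Lemma lp_mem (u : nat -> K^o) (M : R) : 0 <= M ->
  (forall J, \sum_(j < J) modulus (u j) `^ p <= M `^ p) -> u \in @lp_pred R F p p1.
Proof.
by move=> M0 uM; apply/asboolP/(@le_lt_trans _ _ M%:E); [exact/lp_enorm_le|exact: ltry].
Qed.

Lemma lp_sequence_space : exists B : lp -> lp,
  sequence_space (fun (x : lp) j => (x : nat -> K^o) j : K) B.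
Proof.
have mp0 (a : K) : 0 <= modulus a `^ p by exact: powR_ge0.
have shift_sum (x : lp) J M : (forall J, \sum_(j < J) modulus (x j) `^ p <= M) ->
    \sum_(j < J) modulus (x j.+1) `^ p <= M.
  by move=> xM; apply: le_trans (xM J.+1); rewrite big_ord_recl lerDr.
have shift_lp (x : lp) : (fun n => x n.+1) \in @lp_pred R F p p1.
  have [M [_ M0] xM] := lp_sum_le x.
  by apply: (lp_mem M0) => J; exact: shift_sum.
exists (fun x => Lp (shift_lp x)); split=> //.
- by move=> x y xy; apply/val_inj/funext.
- move=> x j; have [M [-> M0] xM] := lp_sum_le x.
  rewrite -of_real_modulus of_real_le leNgt; apply/negP => /(gt0_ltr_powR p_gt0).
  rewrite !nnegrE modulus_ge0 => /(_ M0 isT)/lt_geF; rewrite (le_trans _ (xM j.+1))//.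
  by rewrite big_ord_recr/= lerDr sumr_ge0.
- move=> x; have [M [-> M0] xM] := lp_sum_le x.
  by apply: (lp_norm_le M0) => J; exact: shift_sum.
- move=> u M /sum_modulus_le[ME uM].
  have M0 : 0 <= modulus M by exact: modulus_ge0.
  (* Inclusion of l^1 in l^p: each [|u j| ^ p] is at most [|u j| * M ^ (p - 1)], since every term is
     bounded by the whole sum. *)
  have upM J : \sum_(j < J) modulus (u j) `^ p <= modulus M `^ p.
    rewrite -mulr_powRB1//.
    apply: (@le_trans _ _ ((\sum_(j < J) modulus (u j)) * modulus M `^ (p - 1))).
      rewrite mulr_suml; apply: ler_sum => j _; rewrite -mulr_powRB1 ?modulus_ge0//.
      rewrite ler_wpM2l ?modulus_ge0// ge0_ler_powR ?nnegrE ?modulus_ge0 ?subr_ge0//.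
      apply: le_trans (uM j.+1); rewrite big_ord_recr/= lerDr sumr_ge0// => i _.
      exact: modulus_ge0.
    by rewrite ler_wpM2r ?powR_ge0.
  have ulp := lp_mem M0 upM; exists (Lp ulp) => //.
  by rewrite ME; exact: lp_norm_le.
- move=> x e e0; have [a a0 ->] := gt0_of_real e0.
  have [M [_ M0] xM] := lp_sum_le x.
  have ap0 : 0 < (a / 2) `^ p by rewrite powR_gt0// divr_gt0.
  (* A tail of p-th powers below [(a / 2) ^ p] puts the truncation within [a / 2], strictly less
     than [a]. *)
  have [N xN] := partial_sums_tail (fun j => mp0 (x j)) xM ap0.
  have x'p : (fun n => if (n < N)%N then x n else 0) \in @lp_pred R F p p1.
    apply: (lp_mem M0) => J; apply: le_trans (xM J); apply: ler_sum => j _.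
    by case: ifP => // _; rewrite modulus0 powR0 ?gt_eqF.
  exists N, (Lp x'p); split=> [j Nj /=|]; first by rewrite ltnNge Nj.
  apply: (@le_lt_trans _ _ (of_real F (a / 2))); last first.
    by rewrite of_real_lt; lra.
  apply: lp_norm_le => [|J]; first by rewrite divr_ge0// ltW.
  have -> : \sum_(j < J) modulus ((x - Lp x'p) j) `^ p =
      \sum_(j < J) if (N <= j)%N then modulus (x j) `^ p else 0.
    apply: eq_bigr => j _.
    have -> : (x - Lp x'p) j = x j - (if (j < N)%N then x j else 0) by [].
    by case: ltnP => _; rewrite ?subr0// subrr modulus0 powR0 ?gt_eqF.
  apply: (le_trans _ (xN J)).
  by rewrite -big_mkcond [leRHS]big_geq_mkord.
Qed.

End lp_instance.

(** * Assembly for c_0 and l^p over either scalar field *)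

Theorem theorem3p3 (R : realType) (F : ground)
    (X : normedModType (ground_field R F))
    (hX : X = (c0_space R F : normedModType (ground_field R F)) \/
          exists (p : R) (p1 : 1 <= p),
            X = (lp_space F p1 : normedModType (ground_field R F))) :
  exists S : {linear (X * X)%type -> (X * X)%type},
    [/\ bounded_operator S,
        convex_cyclic S,
        ~ weakly_hypercyclic S &
        ~ convex_cyclic (S \o S)].
Proof.
have [entry [B sp]] : exists (entry : X -> nat -> ground_field R F) (B : X -> X),
    sequence_space entry B.
  by case: hX => [->|[p [p1 ->]]];
    [have [B sp] := c0_sequence_space R F|have [B sp] := lp_sequence_space F p1];
    eexists; exists B; exact: sp.
have [e e_entry e_norm] := unit_vector sp.
have [mu [mu_sum cone far]] := ground_root R F.
have [d dense_d] := ground_dense R F.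
pose S : {linear (X * X)%type -> (X * X)%type} := HB.pack (model_op entry B e mu)
  (GRing.isLinear.Build _ _ _ _ _ (model_op_linear e mu sp)).
exists S.
split=> /=.
- exact: model_op_bounded.
- exact: (convex_cyclic_model_op sp e_entry e_norm mu_sum dense_d
    (@ground_archimedean R F) cone).
- exact: not_weakly_hypercyclic_model_op.
- exact: not_convex_cyclic_sqr_model_op.
Qed.
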